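(* Let $\Sigma=(G,\sigma)$ be a connected signed graph of order $n$. Then $$s^{+}(\Sigma)\ge n-1.$$ Consequently, $$\min\{s^{+}(\Sigma):\Sigma\text{ is a connected signed graph of order }n\}=n-1.$$
   Context: All graphs are finite, simple and undirected. For a graph $G=(V,E)$, the order is $n=|V|$. A signed graph is a pair $\Sigma=(G,\sigma)$, where $G$ is a graph and $\sigma:E(G)\to\{+1,-1\}$; its order is that of $G$, and $\Sigma$ is connected if $G$ is connected. The adjacency matrix $A(\Sigma)=(a_{uv})_{u,v\in V}$ is the real symmetric matrix with $a_{uv}=\sigma(uv)$ if $uv\in E(G)$ and $a_{uv}=0$ otherwise (in particular $a_{uu}=0$). Let $\lambda_1(\Sigma)\ge\cdots\ge\lambda_n(\Sigma)$ be the eigenvalues of $A(\Sigma)$ counted with multiplicity. The positive square energy is $s^{+}(\Sigma)=\sum_{\lambda_i(\Sigma)>0}\lambda_i(\Sigma)^2$. *)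

(* Defs.v *)
From mathcomp Require Import all_boot all_order all_algebra.
From mathcomp Require Import all_classical reals.
From mathcomp Require Import polyrcf.

Set Implicit Arguments.
Unset Strict Implicit.
Unset Printing Implicit Defensive.

Import Order.TTheory GRing.Theory Num.Theory.

Local Open Scope classical_set_scope.
Local Open Scope ring_scope.

Record graph := Graph {
  vertex :> finType;
  adj : rel vertex;
  adj_sym : symmetric adj;
  adj_irrefl : irreflexive adj }.

Definition graph_connected (G : graph) : Prop :=
  (0 < #|G|)%N /\ forall u v : G, connect (@adj G) u v.

(* A map E(G) -> {+1, -1} is encoded as a function of the ordered pair of
   endpoints, constrained only on edges: its values on non-adjacent pairs are
   junk and are never read. *)
Record signed_graph := SignedGraph {
  ugraph :> graph;
  sign : ugraph -> ugraph -> int;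
  sign_sym : forall u v, adj u v -> sign u v = sign v u;
  sign_pm1 : forall u v, adj u v -> sign u v = 1 \/ sign u v = -1 }.

Definition sg_order (S : signed_graph) : nat := #|S|.

Definition sg_connected (S : signed_graph) : Prop := graph_connected S.

(* Rows and columns are indexed through the enumeration of the vertex set. *)
Definition adjmx (R : realType) (S : signed_graph) : 'M[R]_(sg_order S) :=
  \matrix_(i, j)
    let u : S := enum_val i in
    let v : S := enum_val j in
    if adj u v then (sign u v)%:~R else 0.

(* The real eigenvalues in nonincreasing order, each repeated according to its
   multiplicity as a root of the characteristic polynomial; [rootsR p] is the
   increasing list of the distinct real roots of [p].  For a real symmetric
   matrix these are all n eigenvalues. *)
Definition eigenvalues (R : realType) (n : nat) (A : 'M[R]_n) : seq R :=
  flatten [seq nseq (mup x (char_poly A)) x | x <- rev (rootsR (char_poly A))].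

Definition pos_square_energy (R : realType) (S : signed_graph) : R :=
  \sum_(x <- eigenvalues (adjmx R S) | 0 < x) x ^+ 2.

Definition is_min (R : realType) (A : set R) (m : R) : Prop :=
  A m /\ lbound A m.

(* Main.v *)
Require Import Defs.
From mathcomp Require Import all_boot all_order all_algebra.
From mathcomp Require Import all_classical reals.
From mathcomp Require Import ring lra polyrcf complex spectral sesquilinear.
From mathcomp Require Import fintype finset.
Import Order.TTheory GRing.Theory Num.Theory.
Set Implicit Arguments.
Unset Strict Implicit.
Unset Printing Implicit Defensive.
Local Open Scope ring_scope.

(** Let [X] be the negative part of [A], so that [A + X] is its positive part,
    the positive square energy is the squared Frobenius norm of [A + X], and
    (Schur) the matrix of the [|X_ij|^2] is positive semidefinite.  Adding
    [|X_ij|^2 (e_i - e_j)(e_i - e_j)^T] for every non-edge [ij] turns it into a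
    positive semidefinite [Z] supported on [G] with [Z_ij = t_ij^2] on edges, and
    the energy is at least [tr Z] plus the sum of [(1 - t_ij)^2] over ordered
    edges.  That this is at least [n - 1] for every such [Z] is proved by
    induction on [n].  At a cut vertex [Z] is a sum of two matrices of the same
    kind.  If there is no cut vertex, let [M] be the number of ordered edges.
    Summing the induction hypothesis over all vertex deletions, for the optimal
    rescaling of [Z], settles [M <= (n - 1)^2].  Finally, a proper colouring with
    [k] colours gives the lower bound [M / k]: take [k = n] if [G] is complete,
    and otherwise identify two non-adjacent vertices to get [k = n - 1], which
    settles [M >= (n - 1)^2].  The negative complete graph attains the bound. *)

(** * Compatible pairs [Z], [t] and their energy *)

Section Energy.
Variables (R : realType) (V : finType) (e : rel V).
Hypotheses (e_sym : symmetric e) (e_irr : irreflexive e).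
Implicit Types (U A B : {set V}) (Z t : V -> V -> R).

(* Connectedness of the subgraph induced on [U], in the cut form used by the
   induction. *)
Definition linked U := forall A, (0 < #|A|)%N -> A \proper U ->
  exists a b, [/\ a \in A, b \in U :\: A & e a b].

Definition qform U Z (x : V -> R) := \sum_(i in U) \sum_(j in U) x i * x j * Z i j.

(** Only positive semidefiniteness refers to [U], so a pair passes to subsets of [U] unchanged. Off
    the edges, [t] is constrained by symmetry alone. *)
Record compatible U Z t : Prop := Compatible {
  compat_sym : forall i j, Z i j = Z j i;
  compat_tsym : forall i j, t i j = t j i;
  compat_edge : forall i j, e i j -> Z i j = t i j ^+ 2;
  compat_nonedge : forall i j, i != j -> ~~ e i j -> Z i j = 0;
  compat_psd : forall x, 0 <= qform U Z x }.

(** Each edge contributes twice, once per order, to match a squared Frobenius norm. *)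
Definition energy U Z t :=
  \sum_(i in U) Z i i + \sum_(i in U) \sum_(j in U) (1 - t i j) ^+ 2 *+ e i j.

Lemma sum_setD1 (F : V -> R) U v : v \in U ->
  \sum_(i in U) F i = F v + \sum_(i in U :\ v) F i.
Proof. exact: big_setD1. Qed.

Lemma sum2_setD1 (F : V -> V -> R) U v : (forall i j, F i j = F j i) -> v \in U ->
  \sum_(i in U) \sum_(j in U) F i j =
  F v v + 2 * \sum_(j in U :\ v) F v j + \sum_(i in U :\ v) \sum_(j in U :\ v) F i j.
Proof.
move=> Fsym vU; rewrite (sum_setD1 _ vU) (sum_setD1 _ vU).
under [X in _ + X]eq_bigr do rewrite (sum_setD1 _ vU) Fsym.
by rewrite big_split /=; ring.
Qed.

Lemma qform_sub U A Z x : A \subset U ->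
  qform U Z (fun i => if i \in A then x i else 0) = qform A Z x.
Proof.
move=> AU; rewrite /qform [LHS](big_setID A) /= (setIidPr AU).
rewrite [X in _ + X]big1 ?addr0.
  apply: eq_bigr => i iA; rewrite [LHS](big_setID A) /= (setIidPr AU) iA.
  rewrite [X in _ + X]big1 ?addr0; first by apply: eq_bigr => j ->.
  by move=> j; rewrite inE => /andP[/negPf-> _]; rewrite mulr0 mul0r.
move=> i; rewrite inE => /andP[/negPf-> _].
by rewrite big1 // => j _; rewrite !mul0r.
Qed.

Lemma compatible_sub U A Z t : A \subset U -> compatible U Z t -> compatible A Z t.
Proof.
move=> AU [Zs ts Ze Zn Zp]; split=> // x.
by rewrite -(qform_sub _ _ AU).
Qed.

Lemma compatible_scale U Z t c : compatible U Z t ->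
  compatible U (fun i j => c ^+ 2 * Z i j) (fun i j => c * t i j).
Proof.
move=> [Zs ts Ze Zn Zp]; split.
- by move=> i j; rewrite Zs.
- by move=> i j; rewrite ts.
- by move=> i j /Ze->; rewrite exprMn.
- by move=> i j ij nij; rewrite Zn ?mulr0.
move=> x; suff -> : qform U (fun i j => c ^+ 2 * Z i j) x = qform U Z (fun i => c * x i) by [].
by apply: eq_bigr => i _; apply: eq_bigr => j _; ring.
Qed.

Lemma compatible_diag_ge0 U Z t v : compatible U Z t -> v \in U -> 0 <= Z v v.
Proof.
move=> ZC vU; have vsub : [set v] \subset U by rewrite sub1set.
have := compat_psd (compatible_sub vsub ZC) (fun=> 1).
by rewrite /qform !big_set1 !mul1r.
Qed.

Lemma energy_setD1 U Z t v : compatible U Z t -> v \in U ->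
  energy U Z t = energy (U :\ v) Z t + Z v v
    + 2 * \sum_(j in U) (1 - t v j) ^+ 2 *+ e v j.
Proof.
move=> ZC vU; rewrite /energy (sum_setD1 _ vU) (sum2_setD1 _ vU); last first.
  by move=> i j; rewrite (compat_tsym ZC) e_sym.
by rewrite (sum_setD1 (fun j => _ *+ e v j) vU) e_irr mulr0n; ring.
Qed.

(** * Rescaling, and averaging over vertex deletions *)

Definition arcs U := \sum_(i in U) \sum_(j in U) (e i j : nat)%:R : R.

Lemma energy_expand U Z t c :
  energy U (fun i j => c ^+ 2 * Z i j) (fun i j => c * t i j) =
  c ^+ 2 * (\sum_(i in U) Z i i) +
  (arcs U - 2 * c * (\sum_(i in U) \sum_(j in U) t i j *+ e i j)
   + c ^+ 2 * (\sum_(i in U) \sum_(j in U) t i j ^+ 2 *+ e i j)).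
Proof.
rewrite /energy -mulr_sumr /arcs; congr (_ + _).
rewrite !mulr_sumr -sumrB -big_split /=.
apply: eq_bigr => i _; rewrite !mulr_sumr -sumrB -big_split /=.
by apply: eq_bigr => j _; case: (e i j); rewrite ?mulr1n ?mulr0n; ring.
Qed.

(** With [M = arcs U], and with [b] and [a] the sums of [t] and of [t ^+ 2] over ordered edges, the
    nonnegative sum of [(M * t i j - b) ^+ 2] expands to [M * (M * a - b ^+ 2)]. *)
Lemma arcs_CauchySchwarz U t : 0 < arcs U ->
  (\sum_(i in U) \sum_(j in U) t i j *+ e i j) ^+ 2 <=
  arcs U * (\sum_(i in U) \sum_(j in U) t i j ^+ 2 *+ e i j).
Proof.
have expand p q : \sum_(i in U) \sum_(j in U) (p * t i j - q) ^+ 2 *+ e i j =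
    p ^+ 2 * (\sum_(i in U) \sum_(j in U) t i j ^+ 2 *+ e i j)
    - 2 * p * q * (\sum_(i in U) \sum_(j in U) t i j *+ e i j) + q ^+ 2 * arcs U.
  rewrite /arcs !mulr_sumr -sumrB -big_split /=.
  apply: eq_bigr => i _; rewrite !mulr_sumr -sumrB -big_split /=.
  by apply: eq_bigr => j _; case: (e i j); rewrite ?mulr1n ?mulr0n; ring.
set b := (\sum_(i in U) _); set a := (X in _ * X); set M := arcs U => M_gt0.
have : 0 <= \sum_(i in U) \sum_(j in U) (M * t i j - b) ^+ 2 *+ e i j.
  apply: sumr_ge0 => i _; apply: sumr_ge0 => j _.
  by rewrite mulrn_wge0 ?sqr_ge0.
rewrite expand -/a -/b -/M.
have -> : M ^+ 2 * a - 2 * M * b * b + b ^+ 2 * M = M * (M * a - b ^+ 2) by ring.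
by rewrite pmulr_rge0 // subr_ge0.
Qed.


(** Let [Q] be the edge part of the energy [E]. Over all vertex deletions each diagonal term is lost
    once and each edge term twice, so the remaining energies sum to [(n - 1) * E - Q]. At the
    optimal scale, Cauchy-Schwarz gives [E ^+ 2 <= M * Q]. Eliminating [Q] leaves a quadratic
    inequality that traps [E] between two roots, the smaller being [n - 1]. *)
Lemma energy_ge_average U Z t : compatible U Z t -> (2 < #|U|)%N -> 0 < arcs U ->
    arcs U <= (#|U|%:R - 1) ^+ 2 ->
    (forall v Z' t', v \in U -> compatible (U :\ v) Z' t' ->
       #|U|%:R - 2 <= energy (U :\ v) Z' t') ->
  #|U|%:R - 1 <= energy U Z t.
Proof.
move=> ZC U_gt2 M_gt0 M_le IH; set n : R := #|U|%:R.
set tr := \sum_(i in U) Z i i.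
set a := \sum_(i in U) \sum_(j in U) t i j ^+ 2 *+ e i j.
set b := \sum_(i in U) \sum_(j in U) t i j *+ e i j.
set M := arcs U.
have cauchy : b ^+ 2 <= M * a by exact: arcs_CauchySchwarz.
have tr_ge0 : 0 <= tr by apply: sumr_ge0 => i /(compatible_diag_ge0 ZC).
have a_ge0 : 0 <= a.
  by apply: sumr_ge0 => i _; apply: sumr_ge0 => j _; rewrite mulrn_wge0 ?sqr_ge0.
have average c : let E := c ^+ 2 * tr + (M - 2 * c * b + c ^+ 2 * a) in
    n * (n - 2) <= n * E - E - (M - 2 * c * b + c ^+ 2 * a).
  have ZcC := compatible_scale c ZC; rewrite -energy_expand /=; set E := energy _ _ _.
  set Q : R := \sum_(i in U) \sum_(j in U) (1 - c * t i j) ^+ 2 *+ e i j.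
  have EQ : E = c ^+ 2 * tr + Q by rewrite /E /energy -mulr_sumr.
  have <- : Q = M - 2 * c * b + c ^+ 2 * a.
    by apply: (addrI (c ^+ 2 * tr)); rewrite -EQ; exact: energy_expand.
  have -> : n * (n - 2) = \sum_(v in U) (n - 2) by rewrite sumr_const /n mulr_natl.
  have -> : n * E - E - Q = \sum_(v in U) (E - c ^+ 2 * Z v v
      - 2 * \sum_(j in U) (1 - c * t v j) ^+ 2 *+ e v j).
    rewrite !sumrB sumr_const -[E *+ _]mulr_natl -/n -!mulr_sumr -/tr -/Q.
    by rewrite [X in _ - X - Q]EQ; ring.
  apply: ler_sum => v vU.
  rewrite /E (energy_setD1 ZcC vU).
  set rest := 2 * _; rewrite addrAC addrK addrK.
  exact: IH vU (compatible_sub (subsetDl U [set v]) ZcC).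
(* The minimiser of [c ^+ 2 * (tr + a) - 2 * c * b + M]; if [tr + a = 0] then
   [b = 0] too and the junk value [c = 0] is fine. *)
set c := b / (tr + a); have {average} := average c; rewrite /=.
have cE : c ^+ 2 * (tr + a) = c * b.
  rewrite /c; have [->|nz] := eqVneq (tr + a) 0; first by rewrite invr0; ring.
  by field.
have [Ec le_Ec] : c ^+ 2 * tr + (M - 2 * c * b + c ^+ 2 * a) = M - c * b
    /\ M - c * b <= energy U Z t.
  have EE : energy U Z t = tr + (M - 2 * b + a).
    have := energy_expand U Z t 1; rewrite !expr1n !mul1r mulr1 -/tr -/a -/b -/M => <-.
    by congr (_ + _); apply: eq_bigr => i _; rewrite ?mul1r //;
      apply: eq_bigr => j _; rewrite mul1r.
  split.
    by transitivity (c ^+ 2 * (tr + a) + M - 2 * (c * b)); [|rewrite cE]; ring.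
  have [s0|s0] := eqVneq (tr + a) 0.
    have -> : c = 0 by rewrite /c s0 invr0 mulr0.
    have a0 : a = 0 by lra.
    have b0 : b = 0 by apply/eqP; rewrite -sqrf_eq0 eq_le sqr_ge0 andbT; move: cauchy; rewrite a0 mulr0.
    by rewrite EE b0 a0; lra.
  have s_gt0 : 0 < tr + a by rewrite lt_neqAle eq_sym s0 addr_ge0.
  (* This product is the excess of the energy at scale [1] over the energy at scale [c]. *)
  have : 0 <= (tr + a) * (1 - c) ^+ 2 by rewrite mulr_ge0 ?sqr_ge0 // ltW.
  have cs : c * (tr + a) = b by rewrite /c mulfVK.
  rewrite EE; nra.
rewrite Ec; set E := M - c * b in le_Ec * => avg; apply: le_trans le_Ec.
have QE : E ^+ 2 <= M * (M - 2 * c * b + c ^+ 2 * a).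
  have -> : E ^+ 2 = M * (M - 2 * c * b) + c ^+ 2 * b ^+ 2 by rewrite /E; ring.
  by rewrite [leRHS]mulrDr lerD2l [leRHS]mulrCA ler_wpM2l ?sqr_ge0.
have n_ge3 : 3 <= n by rewrite (ler_nat _ 3).
have QE1 : E ^+ 2 <= (n - 1) ^+ 2 * (M - 2 * c * b + c ^+ 2 * a).
  apply: (le_trans QE); apply: ler_wpM2r => //.
  by rewrite -(pmulr_rge0 _ M_gt0); apply: le_trans QE; exact: sqr_ge0.
set q := (M - _ + _) in avg QE1 *.
rewrite leNgt; apply/negP => E_lt.
(* The factors come from the roots of the quadratic obtained by eliminating [q]. As [n >= 3], the
   second root exceeds [n - 1], so [E < n - 1] is impossible. *)
have : 0 <= (n - 1 - E) * (E - (n - 1) * ((n - 1) ^+ 2 - 1)).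
  have -> : (n - 1 - E) * (E - (n - 1) * ((n - 1) ^+ 2 - 1)) =
    (n - 1) ^+ 2 * (n * E - E - q - n * (n - 2)) + ((n - 1) ^+ 2 * q - E ^+ 2) by ring.
  by rewrite addr_ge0 ?subr_ge0 // mulr_ge0 ?sqr_ge0 // subr_ge0.
rewrite pmulr_rge0 ?subr_gt0 // subr_ge0; nra.
Qed.

(** * The colouring bound *)

(** Testing [Z] on the centred indicators of the colour classes bounds its trace below by the sum of
    the [t i j ^+ 2] over ordered edges, divided by [k - 1]. Each ordered edge then contributes
    [t ^+ 2 / (k - 1) + (1 - t) ^+ 2], whose minimum [1 / k] is attained at [t = (k - 1) / k]. *)
Lemma energy_ge_coloring U (K : {set V}) (f : V -> V) Z t :
    compatible U Z t -> (1 < #|K|)%N -> (forall i, i \in U -> f i \in K) ->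
    (forall i j, i \in U -> j \in U -> e i j -> f i != f j) ->
  arcs U / #|K|%:R <= energy U Z t.
Proof.
move=> ZC K_gt1 fK f_proper; set k : R := #|K|%:R.
have k_gt1 : 1 < k by rewrite ltr1n.
(* Summed over the colours [c], the test vectors [x c] pair [i] and [j] with
   weight [1 - 1/k] if [f i = f j] and [- 1/k] otherwise. *)
pose x c i : R := (f i == c)%:R - k^-1.
have xx i j : i \in U -> j \in U ->
    \sum_(c in K) x c i * x c j = (f i == f j)%:R - k^-1.
  move=> iU jU.
  transitivity (\sum_(c in K) ((f i == c)%:R * (f j == c)%:R
     - k^-1 * (f i == c)%:R - k^-1 * (f j == c)%:R + k^-1 ^+ 2)).
    by apply: eq_bigr => c _; rewrite /x; ring.
  have one l : l \in U -> \sum_(c in K) (f l == c)%:R = 1 :> R.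
    move=> lU; rewrite (bigD1 (f l)) ?fK //= eqxx big1 ?addr0 // => c /andP[_].
    by rewrite eq_sym => /negPf->.
  rewrite big_split /= !sumrB -!mulr_sumr !one // sumr_const -mulr_natl -/k.
  rewrite (bigD1 (f i)) ?fK //= eqxx mul1r big1 ?addr0; last first.
    by move=> c /andP[_]; rewrite eq_sym => /negPf->; rewrite mul0r.
  by rewrite eq_sym; field; lra.
have trace_ge : (\sum_(i in U) \sum_(j in U) t i j ^+ 2 *+ e i j) / (k - 1) <= \sum_(i in U) Z i i.
  have : 0 <= \sum_(c in K) qform U Z (x c).
    by apply: sumr_ge0 => c _; exact: compat_psd ZC _.
  have -> : \sum_(c in K) qform U Z (x c) =
      (1 - k^-1) * (\sum_(i in U) Z i i)
      - k^-1 * (\sum_(i in U) \sum_(j in U) t i j ^+ 2 *+ e i j).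
    rewrite exchange_big !mulr_sumr -sumrB; apply: eq_bigr => i iU /=.
    rewrite exchange_big /= (sum_setD1 _ iU).
    rewrite -mulr_suml xx // eqxx (sum_setD1 (fun j => _ *+ e i j) iU) e_irr add0r.
    congr (_ + _); rewrite mulr_sumr -sumrN; apply: eq_bigr => j.
    rewrite !inE => /andP[ji jU]; rewrite -mulr_suml xx //.
    have [eij|/negPf neij] := boolP (e i j).
      by rewrite (negPf (f_proper _ _ iU jU eij)) (compat_edge ZC eij) mulr1n sub0r mulNr.
    by rewrite (compat_nonedge ZC) 1?eq_sym ?neij // mulr0n !mulr0 oppr0.
  set T := \sum_(i in U) \sum_(j in U) _; set tr := \sum_(i in U) _.
  rewrite ler_pdivrMr; last by lra.
  have -> : (1 - k^-1) * tr - k^-1 * T = (tr * (k - 1) - T) / k by field; lra.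
  by rewrite pmulr_lge0 ?invr_gt0 ?subr_ge0 //; lra.
apply: le_trans (lerD trace_ge (lexx _)).
rewrite mulr_suml /arcs mulr_suml -big_split /=; apply: ler_sum => i _.
rewrite !mulr_suml -big_split /=; apply: ler_sum => j _.
case: (e i j); rewrite ?mulr0n ?mul0r ?addr0 // !mulr1n.
rewrite -subr_ge0.
have -> : t i j ^+ 2 / (k - 1) + (1 - t i j) ^+ 2 - 1%:R / k =
   (k * t i j - (k - 1)) ^+ 2 / (k * (k - 1)) by field; apply/andP; split; lra.
by rewrite divr_ge0 ?sqr_ge0 ?mulr_ge0; lra.
Qed.

(** * Splitting at a cut vertex *)

Definition set_diag Z v w i j : R := if (i == v) && (j == v) then w else Z i j.

(** For [v] outside [A] and symmetric [Z], this is the form on [v |: A] at a vector with value [1]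
    at [v], less the constant [Z v v]. *)
Definition border_form A Z v (x : V -> R) :=
  qform A Z x + 2 * \sum_(j in A) x j * Z v j.

Lemma qform_border A Z v x : (forall i j, Z i j = Z j i) -> v \notin A ->
  qform (v |: A) Z x =
  x v ^+ 2 * Z v v + 2 * x v * (\sum_(j in A) x j * Z v j) + qform A Z x.
Proof.
move=> Zs vA; rewrite /qform (sum2_setD1 _ (setU11 v A)) ?setU1K //; last first.
  by move=> i j; rewrite Zs; ring.
by congr (_ + _ + _); rewrite -mulrA mulr_sumr; congr (_ * _);
  apply: eq_bigr => j _; ring.
Qed.

Lemma qform_set_diag A Z v w x : v \notin A -> qform A (set_diag Z v w) x = qform A Z x.
Proof.
move=> vA; apply: eq_bigr => i iA; apply: eq_bigr => j _.
by rewrite /set_diag; case: eqP => // iv; rewrite -iv iA in vA.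
Qed.

(** By homogeneity: if [x v] is nonzero, dividing by it reduces to value [1] at [v], where the
    hypothesis on [w] applies; if [x v = 0], only the form on [A] remains. *)
Lemma compatible_set_diag A Z t v w : v \notin A -> compatible A Z t ->
    (forall x, 0 <= w + border_form A Z v x) ->
  compatible (v |: A) (set_diag Z v w) t.
Proof.
move=> vA ZC w_ge; have [Zs ts Ze Zn Zp] := ZC.
have Ws i j : set_diag Z v w i j = set_diag Z v w j i by rewrite /set_diag andbC Zs.
split=> //.
- move=> i j eij; rewrite /set_diag; case: andP => [[/eqP iv /eqP jv]|_]; last exact: Ze.
  by move: eij; rewrite iv jv e_irr.
- move=> i j ij nij; rewrite /set_diag; case: andP => [[/eqP iv /eqP jv]|_]; last exact: Zn.
  by rewrite iv jv eqxx in ij.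
move=> x; rewrite (qform_border _ Ws vA) qform_set_diag //.
have -> : \sum_(j in A) x j * set_diag Z v w v j = \sum_(j in A) x j * Z v j.
  apply: eq_bigr => j jA; rewrite /set_diag; case: andP => // -[_ /eqP jv].
  by rewrite -jv jA in vA.
rewrite /set_diag eqxx /=; have [->|xv0] := eqVneq (x v) 0.
  by rewrite expr0n /= mul0r mulr0 mul0r !add0r.
have := w_ge (fun i => x i / x v); rewrite /border_form.
rewrite -(@pmulr_rge0 _ (x v ^+ 2)) ?exprn_even_gt0 //; congr (0 <= _).
rewrite !mulrDr mulrCA !mulr_sumr /qform addrA addrAC; congr (_ + _ + _).
  by apply: eq_bigr => j _; field.
by apply: eq_bigr => i _; rewrite !mulr_sumr; apply: eq_bigr => j _; field.
Qed.

Lemma sum_setU (F : V -> R) A B : [disjoint A & B] ->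
  \sum_(i in A :|: B) F i = \sum_(i in A) F i + \sum_(i in B) F i.
Proof.
move=> dAB; rewrite (big_setID A) /= setUK setDUl setDv set0U.
by congr (_ + _); apply: eq_bigl; apply/setP/setDidPl; rewrite disjoint_sym.
Qed.

Lemma sum2_setU (F : V -> V -> R) A B : (forall i j, F i j = F j i) ->
    [disjoint A & B] -> (forall i j, i \in A -> j \in B -> F i j = 0) ->
  \sum_(i in A :|: B) \sum_(j in A :|: B) F i j =
  \sum_(i in A) \sum_(j in A) F i j + \sum_(i in B) \sum_(j in B) F i j.
Proof.
move=> Fs dAB FAB; rewrite sum_setU //; congr (_ + _); apply: eq_bigr => i iAB.
  by rewrite sum_setU // [X in _ + X]big1 ?addr0 // => j; exact: FAB.
by rewrite sum_setU // big1 ?add0r // => j jA; rewrite Fs FAB.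
Qed.

Lemma eq_border_form A Z v x y : {in A, x =1 y} ->
  border_form A Z v x = border_form A Z v y.
Proof.
move=> xy; rewrite /border_form /qform; congr (_ + _ * _).
  by apply: eq_bigr => i iA; apply: eq_bigr => j jA; rewrite !xy.
by apply: eq_bigr => j jA; rewrite xy.
Qed.

(** As no edge joins [A] to [B], the form on [U] at value [1] in [v] is [Z v v] plus a border form
    on each side, and the two sides vary independently. Hence [Z v v] can be shared between them. *)
Lemma compatible_cut U A B Z t v : compatible U Z t -> U = v |: (A :|: B) ->
    v \notin A -> v \notin B -> [disjoint A & B] ->
    (forall a b, a \in A -> b \in B -> ~~ e a b) ->
  exists w1 w2, [/\ w1 + w2 = Z v v, compatible (v |: A) (set_diag Z v w1) t
                  & compatible (v |: B) (set_diag Z v w2) t].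
Proof.
move=> ZC UE vA vB dAB noAB; have [Zs _ _ Zn Zp] := ZC.
have AU : A \subset U by rewrite UE setUCA subsetUl.
have BU : B \subset U by rewrite UE setUA subsetUr.
have glue x y : 0 <= Z v v + border_form A Z v x + border_form B Z v y.
  pose z i := if i == v then 1 else if i \in A then x i else y i.
  have zA i : i \in A -> z i = x i.
    by move=> iA; rewrite /z iA; case: eqP => // iv; rewrite -iv iA in vA.
  have zB i : i \in B -> z i = y i.
    move=> iB; rewrite /z (disjointFl dAB iB).
    by case: eqP => // iv; rewrite -iv iB in vB.
  have ZAB i j : i \in A -> j \in B -> Z i j = 0.
    move=> iA jB; apply: Zn; last exact: noAB.
    by apply: contraTneq iA => ->; rewrite (disjointFl dAB jB).
  have := Zp z; rewrite UE qform_border //; last by rewrite inE negb_or vA.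
  have zv : z v = 1 by rewrite /z eqxx.
  rewrite zv expr1n mul1r mulr1 {1}/qform sum_setU // sum2_setU //; last 2 first.
  - by move=> i j; rewrite Zs; ring.
  - by move=> i j iA jB; rewrite ZAB ?mulr0.
  rewrite -(eq_border_form _ _ zA) -(eq_border_form _ _ zB).
  by congr (0 <= _); rewrite /border_form /qform; ring.
(* [w1] is the least diagonal entry at [v] keeping the [A] side positive
   semidefinite; what is left of [Z v v] suffices for the [B] side by [glue]. *)
pose S := [set - border_form A Z v x | x in [set: V -> R]]%classic.
have S_ub y : ubound S (Z v v + border_form B Z v y).
  by move=> _ [x _ <-]; have := glue x y; lra.
have S_sup : has_sup S.
  split; first by exists (- border_form A Z v (fun=> 0)), (fun=> 0).
  by exists (Z v v + border_form B Z v (fun=> 0)); exact: S_ub.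
exists (sup S), (Z v v - sup S); split; first by ring.
- apply: compatible_set_diag => //; first exact: compatible_sub ZC.
  move=> x; rewrite -[border_form _ _ _ _]opprK subr_ge0.
  by apply: sup_upper_bound => //; exists x.
- apply: compatible_set_diag => //; first exact: compatible_sub ZC.
  move=> y; have : sup S <= Z v v + border_form B Z v y.
    by apply: sup_le_ub; [case: S_sup | exact: S_ub].
  by lra.
Qed.

Lemma energy_set_diag A Z t v w : compatible A Z t -> v \notin A ->
  energy (v |: A) (set_diag Z v w) t =
  w + energy A Z t + 2 * \sum_(j in A) (1 - t v j) ^+ 2 *+ e v j.
Proof.
move=> ZC vA; rewrite /energy big_setU1 //= (sum2_setD1 _ (setU11 v A)); last first.
  by move=> i j; rewrite (compat_tsym ZC) e_sym.
rewrite setU1K // e_irr mulr0n /set_diag eqxx /=.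
have -> : \sum_(i in A) (if (i == v) && (i == v) then w else Z i i) = \sum_(i in A) Z i i.
  by apply: eq_bigr => i iA; case: eqP => // iv; rewrite -iv iA in vA.
by ring.
Qed.

Lemma energy_cut A B Z t v w1 w2 : compatible (v |: (A :|: B)) Z t ->
    v \notin A -> v \notin B -> [disjoint A & B] ->
    (forall a b, a \in A -> b \in B -> ~~ e a b) -> w1 + w2 = Z v v ->
  energy (v |: (A :|: B)) Z t =
  energy (v |: A) (set_diag Z v w1) t + energy (v |: B) (set_diag Z v w2) t.
Proof.
move=> ZC vA vB dAB noAB wE.
have vAB : v \notin A :|: B by rewrite inE negb_or vA.
have sub (X : {set V}) : X \subset A :|: B -> compatible X Z t.
  by move=> XAB; apply: compatible_sub ZC; rewrite subsetU // XAB orbT.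
have CA := sub A (subsetUl _ _); have CB := sub B (subsetUr _ _).
rewrite !energy_set_diag //.
rewrite (energy_setD1 ZC (setU11 _ _)) setU1K // -wE big_setU1 //= e_irr mulr0n add0r.
rewrite /energy (sum_setU (fun i => Z i i)) // (sum_setU (fun j => _ *+ e v j)) //.
rewrite sum2_setU //; last 2 first.
- by move=> i j; rewrite e_sym (compat_tsym ZC).
- by move=> i j iA jB; rewrite (negPf (noAB _ _ iA jB)) mulr0n.
by ring.
Qed.

(** If [C] misses [v], it lies in [A], so an edge leaving it cannot end in [B]. If [C] contains [v],
    the same holds for its complement in [v |: A], and the edge found is reversed. *)
Lemma linked_cut U A B v : linked U -> U = v |: (A :|: B) ->
  (forall a b, a \in A -> b \in B -> ~~ e a b) -> linked (v |: A).
Proof.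
move=> Ul UE noAB C C_gt0 Cprop.
have [/subsetP CvA [x xvA xC]] := properP Cprop.
have inU b : b \in U -> b \notin B -> b \in v |: A.
  by rewrite UE !inE; case: (b \in B); rewrite ?orbF.
have vAU : v |: A \subset U by rewrite UE setUA subsetUl.
have [vC|vC] := boolP (v \in C); last first.
  have [|a [b [aC /setDP[bU bC] eab]]] := Ul C C_gt0.
    by apply: proper_sub_trans vAU.
  exists a, b; split => //; rewrite inE bC inU //.
  apply: contraL eab => /noAB; apply.
  by have /CvA/setU1P[av|//] := aC; rewrite -av aC in vC.
have [||a [b [/setDP[avA aC] /setDP[bU bD] eab]]] := Ul ((v |: A) :\: C).
- by apply/card_gt0P; exists x; rewrite inE xC.
- apply: (@proper_sub_trans _ _ (v |: A)) => //.
  by apply/properP; split; [exact: subsetDl | exists v; rewrite ?setU11 // !inE vC].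
exists b, a; split; [|by rewrite inE aC|by rewrite e_sym].
have bvA : b \in v |: A.
  apply: inU => //; apply: contraL eab => /noAB; apply.
  by have /setU1P[av|//] := avA; rewrite av vC in aC.
by move: bD; rewrite inE bvA andbT negbK.
Qed.

(** * The induction on the number of vertices *)

Lemma arcs_complete U :
    (forall i j, i \in U -> j \in U -> i != j -> e i j) ->
  arcs U = #|U|%:R * (#|U|%:R - 1).
Proof.
move=> Uc; rewrite mulr_natl -sumr_const; apply: eq_bigr => i iU.
rewrite (sum_setD1 _ iU) e_irr add0r (eq_bigr (fun=> 1)).
  by rewrite sumr_const (cardsD1 i U) iU natrD addrAC subrr add0r.
by move=> j; rewrite !inE => /andP[ji jU]; rewrite Uc // eq_sym.
Qed.

Lemma energy_ge U Z t : linked U -> (0 < #|U|)%N -> compatible U Z t ->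
  #|U|%:R - 1 <= energy U Z t.
Proof.
have [n] := ubnP #|U|; elim: n => // n IHn in U Z t *; rewrite ltnS => Un Ul U_gt0 ZC.
have [[v [A [vU A_gt0 AU noA]]]|no_cut] := pselect (exists v A, [/\ v \in U,
    (0 < #|A|)%N, A \proper U :\ v &
    forall a b, a \in A -> b \in (U :\ v) :\: A -> ~~ e a b]).
  set B := (U :\ v) :\: A in noA.
  have ABE : A :|: B = U :\ v.
    apply/setP => x; rewrite /B in_setU (in_setD _ A).
    by have [/(subsetP (proper_sub AU))->|] := boolP (x \in A).
  have UE : U = v |: (A :|: B) by rewrite ABE setD1K.
  have noB b a : b \in B -> a \in A -> ~~ e b a by rewrite e_sym => bB aA; exact: noA.
  have vA : v \notin A by apply: contraTN vU => /(subsetP (proper_sub AU)); rewrite !inE eqxx.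
  have vB : v \notin B by rewrite !inE eqxx andbF.
  have dAB : [disjoint A & B] by rewrite disjoint_sym disjoints_subset subsetDr.
  have cardU : #|U| = (#|A| + #|B|).+1.
    by rewrite (cardsD1 v) vU -ABE cardsU disjoint_setI0 // cards0 subn0.
  have B_gt0 : (0 < #|B|)%N.
    have [_ [b bU bA]] := properP AU.
    by apply/card_gt0P; exists b; rewrite inE bA.
  have [w1 [w2 [wE C1 C2]]] := compatible_cut ZC UE vA vB dAB noA.
  have l1 := linked_cut Ul UE noA.
  have l2 : linked (v |: B) by apply: (linked_cut Ul _ noB); rewrite UE (setUC A).
  have cA : #|v |: A| = #|A|.+1 by rewrite cardsU1 vA.
  have cB : #|v |: B| = #|B|.+1 by rewrite cardsU1 vB.
  have E1 : #|A|.+1%:R - 1 <= energy (v |: A) (set_diag Z v w1) t.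
    rewrite -cA; apply: IHn l1 _ C1; rewrite cA //.
    by apply: leq_trans Un; rewrite cardU !ltnS -[ltnLHS]addn0 ltn_add2l.
  have E2 : #|B|.+1%:R - 1 <= energy (v |: B) (set_diag Z v w2) t.
    rewrite -cB; apply: IHn l2 _ C2; rewrite cB //.
    by apply: leq_trans Un; rewrite cardU !ltnS -[ltnLHS]add0n ltn_add2r.
  (* Since [#|U| - 1 = #|A| + #|B|], the two bounds add up with no loss. *)
  rewrite cardU UE (energy_cut _ vA vB dAB noA wE) -?UE //.
  by move: E1 E2; rewrite -!natr1 natrD; lra.
have Ul_del v : v \in U -> linked (U :\ v).
  move=> vU A A_gt0 AU; apply: contrapT => noA; apply: no_cut.
  exists v, A; split=> // a b aA bA; apply/negP => eab.
  by apply: noA; exists a, b.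
have [[i0 [j0 [i0U j0U ij0 nij0]]]|Uc] := pselect (exists i j,
    [/\ i \in U, j \in U, i != j & ~~ e i j]); last first.
  have {}Uc i j : i \in U -> j \in U -> i != j -> e i j.
    by move=> iU jU ij; apply: contrapT => /negP nij; apply: Uc; exists i, j.
  have [U_le1|U_gt1] := leqP #|U| 1.
    have -> : #|U| = 1%N by apply/eqP; rewrite eqn_leq U_le1.
    rewrite subrr addr_ge0 ?sumr_ge0 // => i iU; first exact: compatible_diag_ge0 ZC iU.
    by rewrite sumr_ge0 // => j _; rewrite mulrn_wge0 ?sqr_ge0.
  (* All vertices get distinct colours, and [arcs U / #|U|] is exactly [#|U| - 1]. *)
  have := energy_ge_coloring (f := id) ZC U_gt1.
  rewrite arcs_complete // mulrC mulKf ?pnatr_eq0 -?lt0n //; apply=> // i j _ _.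
  by apply: contraTneq => ->; rewrite e_irr.
(* A neighbour [b'] of [i0] cannot be [j0]; it makes [arcs U] positive and gives [U :\ j0] a second
   element besides [i0]. *)
have [||b [b' [/set1P-> /setD1P[bi bU] eib]]] := Ul [set i0].
- by rewrite cards1.
- by apply/properP; rewrite sub1set; split=> //; exists j0; rewrite // inE eq_sym.
have bj : b' != j0 by apply: contraNneq nij0 => <-.
have cardU : #|U| = #|U :\ j0|.+1 by rewrite (cardsD1 j0) j0U.
have U_gt2 : (1 < #|U :\ j0|)%N.
  by apply/card_gt1P; exists i0, b'; split; rewrite ?inE ?ij0 ?bj // eq_sym.
have [M_le|M_gt] := lerP (arcs U) ((#|U|%:R - 1) ^+ 2).
  apply: energy_ge_average => //; first by rewrite cardU.
    apply: (@lt_le_trans _ _ 1) => //; rewrite /arcs (sum_setD1 _ i0U) (sum_setD1 _ bU) eib.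
    by rewrite -addrA lerDl addr_ge0 ?sumr_ge0 // => i _; rewrite sumr_ge0.
  move=> v Z' t' vU C'.
  have cardv : #|U| = #|U :\ v|.+1 by rewrite (cardsD1 v) vU.
  have -> : #|U|%:R - 2 = #|U :\ v|%:R - 1 :> R by rewrite cardv -natr1; lra.
  have Uv_gt0 : (0 < #|U :\ v|)%N.
    by rewrite -ltnS -cardv cardU ltnS ltnW.
  by apply: IHn (Ul_del v vU) Uv_gt0 C'; rewrite -cardv.
(* Giving [j0] the colour of [i0] is proper because they are not adjacent. *)
pose f i := if i == j0 then i0 else i.
have := energy_ge_coloring (f := f) ZC U_gt2.
have k_gt0 : 0 < #|U :\ j0|%:R :> R by rewrite ltr0n ltnW.
have kE : #|U|%:R - 1 = #|U :\ j0|%:R :> R by rewrite cardU -natr1 addrK.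
move=> h; apply: le_trans (h _ _).
- by rewrite ler_pdivlMr // kE -expr2 -kE ltW.
- by move=> i iU; rewrite /f; case: eqP => [_|/eqP ij]; rewrite !inE ?ij0 ?ij.
move=> i j iU jU; rewrite /f.
have [->|ij] := eqVneq i j0; have [->|jj] := eqVneq j j0; first by rewrite e_irr.
- by apply: contraTneq => <-; rewrite e_sym.
- by apply: contraTneq => ->.
- by apply: contraTneq => ->; rewrite e_irr.
Qed.


(** * Clearing the non-edges of the entrywise square *)

(** [Z] is the matrix of the [t i j ^+ 2] plus the Laplacian of the non-edge weights [D], whose form
    is half the sum of [(x i - x j) ^+ 2 * D i j]. The Laplacian cancels the entries at non-edges
    and moves them to the diagonal, so the sum of squared distances is exactly the energy of [Z]. *)
Lemma sum_dist_ge U t : linked U -> (0 < #|U|)%N ->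
    (forall i j, t i j = t j i) ->
    (forall x, 0 <= qform U (fun i j => t i j ^+ 2) x) ->
  #|U|%:R - 1 <= \sum_(i in U) \sum_(j in U) ((e i j)%:R - t i j) ^+ 2.
Proof.
move=> Ul U_gt0 ts psd.
pose D i j := t i j ^+ 2 *+ ((i != j) && ~~ e i j).
have Ds i j : D i j = D j i by rewrite /D ts eq_sym e_sym.
have D_ge0 i j : 0 <= D i j by rewrite mulrn_wge0 ?sqr_ge0.
have Dii i : D i i = 0 by rewrite /D eqxx mulr0n.
pose Z i j := t i j ^+ 2 - D i j + (\sum_(k in U) D i k) *+ (i == j).
have sum_diag (F : V -> R) i : i \in U -> \sum_(j in U) F j *+ (i == j) = F i.
  move=> iU; rewrite (sum_setD1 _ iU) eqxx mulr1n big1 ?addr0 // => j /setD1P[ji _].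
  by rewrite eq_sym (negPf ji).
have ZC : compatible U Z t.
  split=> //.
  - by move=> i j; rewrite /Z Ds ts [j == i]eq_sym; have [->|] := eqVneq i j.
  - move=> i j eij; rewrite /Z /D eij andbF subr0.
    by case: eqVneq eij => [->|_ _]; rewrite ?e_irr // addr0.
  - by move=> i j ij nij; rewrite /Z /D ij nij mulr1n subrr add0r (negPf ij).
  move=> x; have -> : qform U Z x = qform U (fun i j => t i j ^+ 2) x +
      (\sum_(i in U) \sum_(j in U) (x i - x j) ^+ 2 * D i j) / 2.
    have Dswap : \sum_(i in U) \sum_(j in U) x j ^+ 2 * D i j =
        \sum_(i in U) \sum_(j in U) x i ^+ 2 * D i j.
      by rewrite exchange_big; do 2!apply: eq_bigr => ? _; rewrite Ds.
    transitivity (qform U (fun i j => t i j ^+ 2) x +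
        (\sum_(i in U) \sum_(j in U) (x i ^+ 2 * D i j - x i * x j * D i j))).
      rewrite /qform -big_split /=; apply: eq_bigr => i iU.
      rewrite sumrB -mulr_sumr -[x i ^+ 2 * _](sum_diag (fun j => x i * x j * \sum_(k in U) D i k) i iU).
      rewrite -sumrB -big_split /=; apply: eq_bigr => j _.
      by rewrite /Z; case: (i == j); rewrite ?mulr1n ?mulr0n; ring.
    congr (_ + _); rewrite mulr_suml.
    have -> : \sum_(i in U) (\sum_(j in U) (x i - x j) ^+ 2 * D i j) / 2 =
        (\sum_(i in U) \sum_(j in U) x i ^+ 2 * D i j
         + \sum_(i in U) \sum_(j in U) x j ^+ 2 * D i j) / 2
        - \sum_(i in U) \sum_(j in U) x i * x j * D i j.
      rewrite -big_split mulr_suml -sumrB /=; apply: eq_bigr => i _.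
      rewrite -big_split !mulr_suml -sumrB /=; apply: eq_bigr => j _.
      by field.
    rewrite Dswap -mulr2n -[_ *+ 2]mulr_natr mulfK ?pnatr_eq0 // -sumrB; apply: eq_bigr => i _.
    by rewrite sumrB.
  rewrite addr_ge0 // divr_ge0 // sumr_ge0 // => i _; rewrite sumr_ge0 // => j _.
  by rewrite mulr_ge0 ?sqr_ge0.
have := energy_ge Ul U_gt0 ZC; congr (_ <= _).
rewrite /energy -big_split /=; apply: eq_bigr => i iU.
rewrite /Z Dii eqxx subr0 mulr1n -(sum_diag (fun j => t i j ^+ 2) i iU) -!big_split /=.
apply: eq_bigr => j _; rewrite /D.
have [<-|ij] := eqVneq i j; first by rewrite e_irr !(mulr1n, mulr0n); ring.
by case: (e i j); rewrite /= !(mulr1n, mulr0n); ring.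
Qed.

End Energy.

(** * Eigenvalues and the negative part of a real symmetric matrix *)

Section Spectrum.
Variable R : realType.

Lemma mup_prod_XsubC (n : nat) (l : 'I_n -> R) x :
  mup x (\prod_i ('X - (l i)%:P)) = count_mem x (codom l).
Proof.
rewrite codomE count_map -big_enum /=; elim: (enum 'I_n) => [|i s IHs].
  by rewrite big_nil mupNroot // root1.
have nz (r : seq 'I_n) : \prod_(j <- r) ('X - (l j)%:P) != 0.
  by rewrite prodf_seq_neq0; apply/allP => j _; rewrite polyXsubC_eq0.
rewrite big_cons mupM ?polyXsubC_eq0 ?nz // IHs /=.
by rewrite -['X - _]expr1 mup_XsubCX; case: eqP.
Qed.

(** Both lists contain each [x] as often as its multiplicity as a root of the characteristic
    polynomial. *)
Lemma perm_eigenvalues (n : nat) (A : 'M[R]_n) (l : 'I_n -> R) :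
  char_poly A = \prod_i ('X - (l i)%:P) -> perm_eq (eigenvalues A) (codom l).
Proof.
move=> Al; apply/allP => x _ /=; apply/eqP; rewrite -mup_prod_XsubC -Al.
have nz : char_poly A != 0 by exact/monic_neq0/char_poly_monic.
rewrite /eigenvalues count_flatten -map_comp sumnE big_map big_rev /=.
rewrite (eq_bigr (fun y => if y == x then mup x (char_poly A) else 0%N)); last first.
  by move=> y _; rewrite count_nseq /=; case: eqP => [->|]; rewrite ?mul1n ?mul0n.
have xroots : (x \in rootsR (char_poly A)) = root (char_poly A) x.
  by rewrite -(roots_on_rootsR nz) in_itv.
have [xr|xNr] := boolP (x \in rootsR (char_poly A)).
  rewrite (bigD1_seq x) ?uniq_roots //= eqxx big1 ?addn0 // => y.
  by move=> /negPf->.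
rewrite mupNroot -?xroots //.
by rewrite big1_seq // => y /andP[_ yr]; case: ifP.
Qed.

Lemma sum_eigenvalues (n : nat) (A : 'M[R]_n) (l : 'I_n -> R) (P : pred R) F :
  perm_eq (eigenvalues A) (codom l) ->
  \sum_(x <- eigenvalues A | P x) F x = \sum_(i | P (l i)) F (l i) :> R.
Proof. by move=> Al; rewrite (perm_big _ Al) codomE big_map big_enum_cond. Qed.

Lemma char_poly_similar (C : comUnitRingType) n (P D : 'M[C]_n) :
  P \in unitmx -> char_poly (invmx P *m D *m P) = char_poly D.
Proof.
move=> Pu; rewrite /char_poly /char_poly_mx.
have -> : 'X%:M - map_mx polyC (invmx P *m D *m P) =
    map_mx polyC (invmx P) *m ('X%:M - map_mx polyC D) *m map_mx polyC P.
  rewrite mulmxBr mulmxBl !map_mxM scalar_mxC -[X in _ = X - _]mulmxA -[X in _ = _ *m X - _]map_mxM mulVmx //.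
  by rewrite map_mx1 mulmx1.
rewrite !det_mulmx mulrAC -det_mulmx -map_mxM mulVmx // map_mx1 det1 mul1r //.
Qed.

Local Open Scope sesquilinear_scope.

(** The Hermitian spectral theorem is applied over [R[i]]. The eigenvalues are real, so the
    factorisation of the characteristic polynomial descends to [R] by injectivity of the
    embedding. *)
Lemma symmetric_spectral n (A : 'M[R]_n) : A^T = A ->
  exists l (P : 'M[R[i]]_n), [/\ P \is unitarymx,
    map_mx (real_complex R) A = P ^t* *m diag_mx (\row_i (l i)%:C%C) *m P
    & char_poly A = \prod_i ('X - (l i)%:P)].
Proof.
move=> Asym; set AC := map_mx (real_complex R) A.
have AC_herm : AC \is hermsymmx.
  apply: realsym_hermsym; last first.
    by apply/mxOverP => i j; rewrite mxE complex_real.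
  by apply/is_hermitianmxP; rewrite expr0 scale1r map_mx_id // /AC map_trmx Asym.
have Pu := spectral_unitarymx AC.
pose l i := complex.Re (spectral_diag AC 0 i).
have lE : \row_i (l i)%:C%C = spectral_diag AC.
  apply/rowP => i; rewrite mxE RRe_real //.
  exact: (mxOverP (hermitian_spectral_diag_real AC_herm)).
have /orthomx_spectralP ACE := hermitian_normalmx AC_herm.
exists l, (spectralmx AC); split=> //; first by rewrite lE -invmx_unitary.
apply: (map_poly_inj (real_complex R)).
rewrite map_char_poly -/AC {1}ACE char_poly_similar ?spectral_unit //.
rewrite char_poly_trig ?diag_mx_is_trig // rmorph_prod /=; apply: eq_bigr => i _.
by rewrite rmorphB /= map_polyX map_polyC mxE eqxx mulr1n -lE mxE.
Qed.

Lemma exchange_big4 (I : finType) (V : nmodType) (F : I -> I -> I -> I -> V) :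
  \sum_i \sum_j \sum_k \sum_m F i j k m = \sum_k \sum_m \sum_i \sum_j F i j k m.
Proof.
rewrite pair_big [RHS]pair_big /=.
under eq_bigr do rewrite pair_big /=.
by under [RHS]eq_bigr do rewrite pair_big /=; rewrite exchange_big.
Qed.

Lemma negative_part n (A : 'M[R]_n) : A^T = A ->
  exists (l : 'I_n -> R) (t : 'I_n -> 'I_n -> R), [/\ char_poly A = \prod_i ('X - (l i)%:P),
    forall i j, t i j = t j i,
    forall x, 0 <= \sum_i \sum_j x i * x j * t i j ^+ 2
    & \sum_i \sum_j (`|A i j| - t i j) ^+ 2 <= \sum_(i | 0 < l i) l i ^+ 2].
Proof.
move=> Asym; have [l [P [Pu ACE lE]]] := symmetric_spectral Asym.
(* Functional calculus: [spec f] is [f] applied to [A], and [X] below is the negative part. *)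
pose spec f : 'M[R[i]]_n := P ^t* *m diag_mx (\row_k (f (l k))%:C%C) *m P.
have specE f i j : spec f i j = \sum_k (f (l k))%:C%C * (P k i)^* * P k j.
  rewrite mxE; apply: eq_bigr => k _; rewrite mul_mx_diag !mxE.
  by congr (_ * _); rewrite mulrC.
have conjR (r : R) : (r%:C%C)^* = r%:C%C :> R[i].
  by apply/CrealP; rewrite complex_real.
have spec_conj f i j : (spec f i j)^* = spec f j i.
  rewrite !specE rmorph_sum; apply: eq_bigr => k _ /=.
  by rewrite !rmorphM /= conjCK conjR -!mulrA; congr (_ * _); rewrite mulrC.
pose X := spec (fun y => Num.max 0 (- y)).
pose t i j := complex.Re `|X i j|.
have tE i j : (t i j)%:C%C = `|X i j| by rewrite RRe_real ?normr_real.
have AX : map_mx (real_complex R) A + X = spec (fun y => Num.max 0 y).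
  rewrite ACE /X /spec -mulmxDl -mulmxDr -raddfD; congr (_ *m diag_mx _ *m _).
  apply/rowP => k; rewrite !mxE -rmorphD; congr (_%:C%C).
  by case: (lerP 0 (l k)) => lk; case: (lerP 0 (- l k)) => lk'; lra.
exists l, t; split=> //.
- by move=> i j; rewrite /t -[X j i]spec_conj norm_conjC.
- move=> x; rewrite -ler0c.
  (* Schur product argument: expanding [X i j] and its conjugate in the eigenbasis turns the form
     into a sum of the [|S k m|^2] with weights [N k * N m >= 0]. *)
  pose N k : R[i] := (Num.max 0 (- l k))%:C%C.
  have N_ge0 k : 0 <= N k by rewrite /N ler0c le_max lexx.
  pose S k m := \sum_i (x i)%:C%C * (P k i)^* * P m i.
  suff -> : (\sum_i \sum_j x i * x j * t i j ^+ 2)%:C%C =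
      \sum_k \sum_m N k * N m * (S k m * (S k m)^*).
    apply: sumr_ge0 => k _; apply: sumr_ge0 => m _.
    by apply: mulr_ge0; [exact: mulr_ge0 | exact: mul_conjC_ge0].
  transitivity (\sum_i \sum_j \sum_k \sum_m
      (N k * N m) * (((x i)%:C%C * (P k i)^* * P m i) * ((x j)%:C%C * P k j * (P m j)^*))).
    rewrite rmorph_sum; apply: eq_bigr => i _; rewrite rmorph_sum; apply: eq_bigr => j _.
    rewrite rmorphM rmorphXn /= tE normCK spec_conj /X !specE -!/(N _) big_distrlr /= mulr_sumr.
    apply: eq_bigr => k _; rewrite mulr_sumr; apply: eq_bigr => m _.
    by rewrite rmorphM /= /N; ring.
  rewrite exchange_big4; apply: eq_bigr => k _; apply: eq_bigr => m _.
  rewrite /S rmorph_sum /= big_distrlr /= mulr_sumr; apply: eq_bigr => i _.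
  rewrite mulr_sumr; apply: eq_bigr => j _; congr (_ * (_ * _)).
  by rewrite !rmorphM /= conjCK conjR.
rewrite -lecR (big_mkcond (fun i => 0 < l i)) /=.
(* The trace of the square of the positive part, computed from its eigenvalues and from its
   entries. *)
have -> : (\sum_i (if 0 < l i then l i ^+ 2 else 0))%:C%C =
    \sum_i \sum_j `|spec (fun y => Num.max 0 y) i j| ^+ 2.
  set Y := spec _; transitivity (\tr (Y *m Y)).
    rewrite /Y /spec !mulmxA mulmxtVK // -mulmxA mxtrace_mulC mulmxA.
    rewrite mulmxtVK //.
    rewrite rmorph_sum; apply: eq_bigr => k _; rewrite mul_diag_mx !mxE eqxx mulr1n.
    by rewrite -rmorphM /= -expr2; case: ltP => // _; rewrite expr0n.
  apply: eq_bigr => i _; rewrite mxE; apply: eq_bigr => j _.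
  by rewrite normCK spec_conj.
rewrite -AX rmorph_sum; apply: ler_sum => i _; rewrite rmorph_sum; apply: ler_sum => j _.
rewrite rmorphXn rmorphB /= tE -real_normK; last by rewrite realB ?normr_real // complex_real.
(* What remains is the reverse triangle inequality between [A i j] and [- X i j]. *)
rewrite ler_sqr ?nnegrE ?normr_ge0 //.
have -> : (`|A i j|)%:C%C = `|map_mx (real_complex R) A i j| by rewrite mxE normc_def /= expr0n addr0 sqrtr_sqr.
by have := ler_dist_dist (map_mx (real_complex R) A i j) (- X i j); rewrite normrN opprK => /le_trans; apply; rewrite [in leRHS]mxE.
Qed.

End Spectrum.

(** * The lower bound for signed graphs *)

Lemma linked_connected (G : graph) : graph_connected G -> linked (@adj G) [set: G].
Proof.
move=> [_ Gconn] A /card_gt0P[a aA] /properP[_ [b _ bA]].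
apply: contrapT => noedge.
have A_closed : closed (@adj G) A.
  apply: (intro_closed (sym_connect_sym (@adj_sym G))) => u v uv uA.
  apply: contrapT => /negP vA; apply: noedge; exists u, v.
  by rewrite inE vA inE.
by have := closed_connect A_closed (Gconn a b); rewrite aA (negPf bA).
Qed.

Lemma pos_square_energyE (R : realType) (S : signed_graph)
    (l : 'I_(sg_order S) -> R) :
    char_poly (adjmx R S) = \prod_i ('X - (l i)%:P) ->
  pos_square_energy R S = \sum_(i | 0 < l i) l i ^+ 2.
Proof. by move=> /perm_eigenvalues/sum_eigenvalues; apply. Qed.

Lemma adjmx_sym (R : realType) (S : signed_graph) : (adjmx R S)^T = adjmx R S.
Proof.
apply/matrixP => i j; rewrite !mxE /= adj_sym; case: ifP => // uv.
by rewrite (sign_sym uv).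
Qed.

(** Here the signs disappear: the moduli of the entries depend on the underlying graph only. *)
Lemma norm_adjmx (R : realType) (S : signed_graph) i j :
  `|adjmx R S i j| = (adj (enum_val i : S) (enum_val j))%:R.
Proof.
rewrite mxE /=; case: ifP => [uv|_]; last by rewrite normr0.
case: (sign_pm1 uv) => ->; first by rewrite normr1.
by rewrite rmorphN normrN1.
Qed.

Lemma pos_square_energy_ge (R : realType) (S : signed_graph) :
  sg_connected S -> (sg_order S)%:R - 1 <= pos_square_energy R S.
Proof.
move=> Sconn; have [l [t [lE ts psd le_t]]] := negative_part (adjmx_sym R S).
rewrite (pos_square_energyE lE); apply: le_trans le_t.
pose e : rel S := @adj S.
pose t' (u v : S) := t (enum_rank u) (enum_rank v).
have reindexV (F : S -> S -> R) : \sum_(u in [set: S]) \sum_(v in [set: S]) F u v =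
    \sum_(i < #|S|) \sum_(j < #|S|) F (enum_val i) (enum_val j).
  rewrite (reindex (@enum_val S predT)) /=; last exact/onW_bij/enum_val_bij.
  apply: eq_big => [i|i _]; rewrite ?inE //.
  rewrite (reindex (@enum_val S predT)) /=; last exact/onW_bij/enum_val_bij.
  by apply: eq_bigl => j; rewrite inE.
have := sum_dist_ge (@adj_sym S) (@adj_irrefl S) (U := [set: S]) (t := t')
  (linked_connected Sconn).
rewrite reindexV cardsT => /(_ Sconn.1) h; apply: (le_trans (h _ _)).
- by move=> u v; rewrite /t' ts.
- move=> x; rewrite /qform reindexV.
  have := psd (fun i => x (enum_val i)); congr (0 <= _).
  by apply: eq_bigr => i _; apply: eq_bigr => j _; rewrite /t' !enum_valK.
rewrite le_eqVlt; apply/orP; left; apply/eqP.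
apply: eq_bigr => i _; apply: eq_bigr => j _.
by rewrite norm_adjmx /t' !enum_valK.
Qed.

(** * The extremal example *)

Definition complete_graph (n : nat) : graph :=
  @Graph 'I_n (fun i j => i != j)
    (fun i j => congr1 negb (eq_sym i j)) (fun i => negbF (eqxx i)).

Definition neg_complete (n : nat) : signed_graph :=
  @SignedGraph (complete_graph n) (fun _ _ => -1)
    (fun _ _ _ => erefl) (fun _ _ _ => or_intror erefl).

Lemma neg_complete_connected (n : nat) : (0 < n)%N -> sg_connected (neg_complete n).
Proof.
move=> n_gt0; split; first by rewrite card_ord.
move=> u v; have [->|uv] := eqVneq u v; first exact: connect0.
exact: connect1.
Qed.

(** The matrix is [I - J] with [J] all ones. An eigenvector with entry sum [0] has eigenvalue [1];
    otherwise summing the eigenvalue equation over the coordinates gives [1 - n]. The value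
    [1 - n <= 0] does occur, so at most [n - 1] eigenvalues are positive, each equal to [1]. *)
Lemma neg_complete_energy (R : realType) (n : nat) : (0 < n)%N ->
  pos_square_energy R (neg_complete n) <= n%:R - 1.
Proof.
move=> n_gt0; set S := neg_complete n; set A := adjmx R S.
have ordS : sg_order S = n by rewrite /sg_order card_ord.
have card_index : #|'I_(sg_order S)| = n by rewrite card_ord.
have [l [t [lE _ _ _]]] := negative_part (adjmx_sym R S).
rewrite (pos_square_energyE lE).
have AE i j : A i j = (i == j)%:R - 1.
  by rewrite mxE /= (inj_eq enum_val_inj); case: eqP => _; rewrite ?subrr // sub0r rmorphN.
have mulA v j : (v *m A) 0 j = v 0 j - \sum_i v 0 i.
  rewrite mxE (eq_bigr (fun i => v 0 i *+ (i == j) - v 0 i)).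
    by rewrite sumrB (bigD1 j) //= eqxx mulr1n big1 ?addr0 // => i /negPf->.
  by move=> i _; rewrite AE; case: (i == j); rewrite ?mulr1n ?mulr0n; ring.
have root_l i : root (char_poly A) (l i).
  by rewrite lE (bigD1 i) //= rootM root_XsubC eqxx.
have l_or i : l i = 1 \/ l i = 1 - n%:R.
  have /eigenvalueP[v vA v_neq0] : eigenvalue A (l i) by rewrite eigenvalue_root_char.
  have vE j : v 0 j - \sum_k v 0 k = l i * v 0 j by rewrite -mulA vA mxE.
  set s := \sum_k v 0 k in vE.
  have [s0|s_neq0] := eqVneq s 0.
    left; have [j vj] : exists j, v 0 j != 0.
      apply/existsP; apply: contraNT v_neq0 => /existsPn v0.
      by apply/eqP/rowP => j; rewrite mxE; apply/eqP; have := v0 j; rewrite negbK.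
    by apply: (mulIf vj); rewrite -vE s0 subr0 mul1r.
  right; apply: (mulIf s_neq0); rewrite {1}/s mulr_sumr.
  rewrite -(eq_bigr _ (fun j _ => vE j)) sumrB sumr_const card_index -/s.
  by rewrite mulrBl mul1r mulr_natl.
(* The all-ones vector is an eigenvector for [1 - n]. *)
have [i0 li0] : exists i0, l i0 = 1 - n%:R.
  have : root (char_poly A) (1 - n%:R).
    rewrite -eigenvalue_root_char; apply/eigenvalueP; exists (const_mx 1).
      apply/rowP => j; rewrite mulA !mxE (eq_bigr (fun=> 1)); last by move=> i _; rewrite mxE.
      by rewrite sumr_const card_index mulr1.
    have j0 : 'I_(sg_order S) by rewrite ordS; exact: Ordinal n_gt0.
    by apply/eqP => /rowP/(_ j0); rewrite !mxE; apply/eqP; rewrite oner_eq0.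
  rewrite lE /root horner_prod prodf_seq_eq0 => /hasP[i0 _ /=].
  by rewrite hornerXsubC subr_eq0 => /eqP->; exists i0.
have n_ge1 : 1 <= n%:R :> R by rewrite ler1n.
rewrite big_mkcond (bigD1 i0) //= li0 ltNge subr_le0 n_ge1 /= add0r.
apply: (@le_trans _ _ (\sum_(i | i != i0) 1)).
  apply: ler_sum => i _; case: ifP => // l_gt0.
  have [->|li] := l_or i; first by rewrite expr1n.
  by move: l_gt0; rewrite li; lra.
rewrite sumr_const cardC1 card_index.
by rewrite -[in leRHS](prednK n_gt0) -natr1 addrK.
Qed.

Local Open Scope classical_set_scope.
Local Open Scope ring_scope.

Theorem corollary1p2 (R : realType) (n : nat) (n_gt0 : (0 < n)%N) :
  (forall S : signed_graph, sg_connected S -> sg_order S = n ->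
     n%:R - 1 <= pos_square_energy R S)
  /\
  is_min [set s : R | exists S : signed_graph,
            [/\ sg_connected S, sg_order S = n & s = pos_square_energy R S]]
         (n%:R - 1).
Proof.
have lb S : sg_connected S -> sg_order S = n -> n%:R - 1 <= pos_square_energy R S.
  by move=> Sconn <-; exact: pos_square_energy_ge.
split=> //; split; last by move=> _ [S [Sconn Sn ->]]; exact: lb.
have conn := neg_complete_connected n_gt0.
have ord : sg_order (neg_complete n) = n by exact: card_ord.
exists (neg_complete n); split=> //.
by apply/eqP; rewrite eq_le lb // neg_complete_energy.
Qed.
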